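(* Let $p>3$ be a prime and let $r\ge 1$ be an integer. Let $x,c$ be indeterminates over $\mathbb{Q}_p$, and let $c_1,\dots,c_r$ (in a splitting field over $\mathbb{Q}_p(x)$) satisfy $x(c-1)^r+c^{r-1}=x\prod_{i=1}^r(c-c_i)$. Then $$\sum_{0<k<p}\binom{rk}{k}\frac{x^k}{k}\equiv\frac1p\biggl(2-(r-2)x^p\sum_{i=1}^r(c_i^p-1)-rx^p\sum_{i=1}^r(1-c_i)^p\biggr)+prx^p\sum_{i=1}^r\bigl(\pounds_2(c_i)-\pounds_2(1-c_i)\bigr)\pmod{p^2}.$$
   Context: $\pounds_2(t)=\sum_{k=1}^{p-1}t^k/k^2$ is the finite dilogarithm. Interpretation of the congruence: both sides are symmetric in $c_1,\dots,c_r$ and hence lie in $\mathbb{Q}_p(x)$; for $A,B\in\mathbb{Q}_p(x)$, $A\equiv B\pmod{p^n}$ means $A-B\in p^nR$, where $R$ is the valuation ring of $\mathbb{Q}_p(x)$ with respect to the $p$-adic (Gauss) valuation, i.e. the valuation extending $v_p$ with $v(\sum_j a_jx^j)=\min_j v_p(a_j)$ on polynomials. *)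

(* Defs.v *)
From HB Require Import structures.
From mathcomp Require Import all_boot all_order all_algebra all_field.
From mathcomp Require Import boolp classical_sets constructive_ereal.

Set Implicit Arguments.
Unset Strict Implicit.
Unset Printing Implicit Defensive.

Import Order.TTheory GRing.Theory Num.Theory.
Local Open Scope ring_scope.

(* Z_p as the inverse limit of the rings Z/p^(n+1); the exponent starts at 1
   because 'Z_1 is not the trivial ring. *)
Record padic_int (p : nat) (p_pr : prime p) := PadicInt {
  residue :> forall n : nat, 'Z_(p ^ n.+1);
  residue_coherent : forall n : nat,
    residue n = (residue n.+1 : nat)%:R :> 'Z_(p ^ n.+1)
}.

Section PadicIntRing.
Variables (p : nat) (p_pr : prime p).
Local Notation Zp := (padic_int p_pr).
Implicit Types a b c : Zp.

Lemma padic_intP a b : (forall n, a n = b n) -> a = b.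
Proof.
case: a b => [f fP] [g gP] /= fg.
have {}fg : f = g by apply: functional_extensionality_dep.
by case: _ / fg gP => gP; congr PadicInt; apply: Prop_irrelevance.
Qed.

HB.instance Definition _ := gen_eqMixin Zp.
HB.instance Definition _ := gen_choiceMixin Zp.

Lemma pexp_gt1 n : (1 < p ^ n.+1)%N.
Proof. by rewrite -{1}(exp1n n.+1) ltn_exp2r ?prime_gt1. Qed.

Lemma natr_modZ n k :
  (k %% (Zp_trunc (p ^ n.+2)).+2)%:R = k%:R :> 'Z_(p ^ n.+1).
Proof.
have dvd : (p ^ n.+1 %| p ^ n.+2)%N by rewrite dvdn_exp2l.
rewrite [X in (_ %% X)%N](Zp_cast (pexp_gt1 n.+1)).
by rewrite -[LHS](Zp_nat_mod (pexp_gt1 n)) modn_dvdm // Zp_nat_mod // pexp_gt1.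
Qed.

Fact coherent0 n : 0 = (nat_of_ord (0 : 'Z_(p ^ n.+2)))%:R :> 'Z_(p ^ n.+1).
Proof. by []. Qed.

Fact coherent1 n : 1 = (nat_of_ord (1 : 'Z_(p ^ n.+2)))%:R :> 'Z_(p ^ n.+1).
Proof. by []. Qed.

Fact coherentN a n : - a n = (nat_of_ord (- a n.+1))%:R.
Proof.
rewrite residue_coherent /= natr_modZ natrB; last by rewrite ltnW.
by rewrite -[X in _ = X - _](natr_modZ n) modnn sub0r.
Qed.

Fact coherentD a b n : a n + b n = (nat_of_ord (a n.+1 + b n.+1))%:R.
Proof. by rewrite [a n]residue_coherent [b n]residue_coherent -natrD -natr_modZ. Qed.

Fact coherentM a b n : a n * b n = (nat_of_ord (a n.+1 * b n.+1))%:R.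
Proof. by rewrite [a n]residue_coherent [b n]residue_coherent -natrM -natr_modZ. Qed.

Definition padic_int_zero : Zp := PadicInt p_pr coherent0.
Definition padic_int_one : Zp := PadicInt p_pr coherent1.
Definition padic_int_opp a : Zp := PadicInt p_pr (coherentN a).
Definition padic_int_add a b : Zp := PadicInt p_pr (coherentD a b).
Definition padic_int_mul a b : Zp := PadicInt p_pr (coherentM a b).

Fact padic_int_addA : associative padic_int_add.
Proof. by move=> a b c; apply: padic_intP => n /=; exact: addrA. Qed.
Fact padic_int_addC : commutative padic_int_add.
Proof. by move=> a b; apply: padic_intP => n /=; exact: addrC. Qed.
Fact padic_int_add0 : left_id padic_int_zero padic_int_add.
Proof. by move=> a; apply: padic_intP => n /=; exact: add0r. Qed.
Fact padic_int_addN : left_inverse padic_int_zero padic_int_opp padic_int_add.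
Proof. by move=> a; apply: padic_intP => n /=; exact: addNr. Qed.

HB.instance Definition _ := GRing.isZmodule.Build Zp
  padic_int_addA padic_int_addC padic_int_add0 padic_int_addN.

Fact padic_int_mulA : associative padic_int_mul.
Proof. by move=> a b c; apply: padic_intP => n /=; exact: mulrA. Qed.
Fact padic_int_mulC : commutative padic_int_mul.
Proof. by move=> a b; apply: padic_intP => n /=; exact: mulrC. Qed.
Fact padic_int_mul1 : left_id padic_int_one padic_int_mul.
Proof. by move=> a; apply: padic_intP => n /=; exact: mul1r. Qed.
Fact padic_int_mulD : left_distributive padic_int_mul padic_int_add.
Proof. by move=> a b c; apply: padic_intP => n /=; exact: mulrDl. Qed.
Fact padic_int_one_neq0 : padic_int_one != 0.
Proof. by apply/eqP => /(congr1 (fun a : Zp => a 0%N))/eqP; rewrite oner_eq0. Qed.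

HB.instance Definition _ := GRing.Zmodule_isComNzRing.Build Zp
  padic_int_mulA padic_int_mulC padic_int_mul1 padic_int_mulD
  padic_int_one_neq0.

Lemma residueM a b n : (a * b) n = a n * b n. Proof. by []. Qed.

(* v_p on Z_p: n is least with nonzero residue mod p^(n+1), so p^n divides a
   exactly *)
Definition padic_int_val a : \bar int :=
  if pselect (exists n, a n != 0) is left nz then (ex_minn nz)%:Z%:E
  else +oo%E.

Lemma residue_mod a m n : (m <= n)%N -> (a n = a m %[mod p ^ m.+1])%N.
Proof.
elim: n => [|n IHn]; first by rewrite leqn0 => /eqP->.
rewrite leq_eqVlt => /predU1P[->//|]; rewrite ltnS => le_mn.
rewrite -IHn // [in RHS]residue_coherent val_Zp_nat ?pexp_gt1 //.
by rewrite modn_dvdm // dvdn_exp2l.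
Qed.

Lemma residue_eq0 a m n : (m <= n)%N -> (a m == 0) = (p ^ m.+1 %| a n)%N.
Proof.
move=> le_mn; rewrite /dvdn (residue_mod a le_mn) modn_small //.
by rewrite -[ltnRHS](Zp_cast (pexp_gt1 m)).
Qed.

Lemma padic_int_eq0 a : (forall n, a n = 0) -> a = 0.
Proof. by move=> a0; apply: padic_intP. Qed.

Lemma padic_int_valE a n :
  padic_int_val a = n%:Z%:E <-> a n != 0 /\ forall m, (m < n)%N -> a m = 0.
Proof.
rewrite /padic_int_val; case: pselect => [nz|z]; last first.
  by split=> // -[an _]; case: z; exists n.
case: ex_minnP => k ak kmin; split=> [[<-]|[an nmin]].
  by split=> // m; apply: contraTeq => /kmin; rewrite -leqNgt.
congr (_%:Z%:E); apply/eqP; rewrite eqn_leq kmin // leqNgt.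
by apply/negP => /nmin ak0; rewrite ak0 eqxx in ak.
Qed.

Lemma padic_int_val_eqy a : (padic_int_val a = +oo%E) <-> a = 0.
Proof.
rewrite /padic_int_val; case: pselect => [nz|z].
  by split=> // a0; exfalso; case: nz => n; rewrite a0 eqxx.
by split=> // _; apply: padic_int_eq0 => n; apply: contra_notP z => /eqP; exists n.
Qed.

Lemma padic_int_val_fin a : a != 0 -> exists n : nat, padic_int_val a = n%:Z%:E.
Proof.
move=> a0; have := padic_int_val_eqy a; rewrite /padic_int_val.
case: pselect => [nz _|_ [+ _]]; first by exists (ex_minn nz).
by move=> /(_ erefl)/eqP; rewrite (negPf a0).
Qed.

Lemma padic_int_val_logn a n N : (n <= N)%N ->
  padic_int_val a = n%:Z%:E -> (0 < a N)%N /\ logn p (a N) = n.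
Proof.
move=> le_nN /padic_int_valE[an amin].
have ndvd : ~~ (p ^ n.+1 %| a N)%N by rewrite -residue_eq0.
have aN : (0 < a N)%N by rewrite lt0n; apply: contra ndvd => /eqP->.
split=> //; apply/eqP; rewrite eqn_leq -ltnS ltnNge -!pfactor_dvdn // ndvd /=.
case: n le_nN {an ndvd} amin => [|n] le_nN amin; first exact: dvd1n.
by rewrite -residue_eq0 ?amin // ltnW.
Qed.

Lemma padic_int_valM_fin a b (m n : nat) :
  padic_int_val a = m%:Z%:E -> padic_int_val b = n%:Z%:E ->
  padic_int_val (a * b) = (m + n)%N%:Z%:E.
Proof.
move=> va vb; have [a0 la] := padic_int_val_logn (leq_addr n m) va.
have [b0 lb] := padic_int_val_logn (leq_addl m n) vb.
have dvdE k : (k <= m + n)%N -> ((a * b) k == 0) = (k < m + n)%N.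
  move=> le_k; rewrite (residue_eq0 _ le_k) residueM /=.
  rewrite [X in (_ %| _ %% X)%N](Zp_cast (pexp_gt1 (m + n))).
  rewrite /dvdn modn_dvdm ?dvdn_exp2l // -/(dvdn _ _).
  by rewrite pfactor_dvdn ?muln_gt0 ?a0 // lognM // la lb.
apply/padic_int_valE; split=> [|k lt_k]; first by rewrite dvdE // ltnn.
by apply/eqP; rewrite dvdE // ltnW.
Qed.

Lemma padic_int_valM a b :
  padic_int_val (a * b) = (padic_int_val a + padic_int_val b)%E.
Proof.
have [->|a0] := eqVneq a 0.
  rewrite mul0r (padic_int_val_eqy 0).2 //.
  have [->|/padic_int_val_fin[n ->]//] := eqVneq b 0.
  by rewrite (padic_int_val_eqy 0).2.
have [m va] := padic_int_val_fin a0.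
have [->|/padic_int_val_fin[n vb]] := eqVneq b 0.
  by rewrite mulr0 (padic_int_val_eqy 0).2 // va.
by rewrite (padic_int_valM_fin va vb) va vb.
Qed.

Definition padic_int_unit : {pred Zp} := fun a => `[< exists b, b * a = 1 >].
Definition padic_int_inv a : Zp :=
  if pselect (exists b, b * a = 1) is left ex then projT1 (cid ex) else a.

Fact padic_int_mulV : {in padic_int_unit, left_inverse 1 padic_int_inv *%R}.
Proof.
move=> a /asboolP ua; rewrite /padic_int_inv; case: pselect => // ex.
exact: projT2 (cid ex).
Qed.
Fact padic_int_unitPl a b : b * a = 1 -> padic_int_unit a.
Proof. by move=> ba1; apply/asboolP; exists b. Qed.
Fact padic_int_inv_out : {in [predC padic_int_unit], padic_int_inv =1 id}.
Proof.
move=> a /asboolP ua; rewrite /padic_int_inv.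
by case: pselect.
Qed.

HB.instance Definition _ := GRing.ComNzRing_hasMulInverse.Build Zp
  padic_int_mulV padic_int_unitPl padic_int_inv_out.

Fact padic_int_idomain a b : a * b = 0 -> (a == 0) || (b == 0).
Proof.
move=> ab0; apply/norP => -[/padic_int_val_fin[m va] /padic_int_val_fin[n vb]].
by have := padic_int_valM_fin va vb; rewrite ab0 (padic_int_val_eqy 0).2.
Qed.

HB.instance Definition _ := GRing.ComUnitRing_isIntegral.Build Zp
  padic_int_idomain.

End PadicIntRing.

Definition padic (p : nat) (p_pr : prime p) : fieldType :=
  {fraction (padic_int p_pr)}.

(* The extension v(n/d) = v(n) - v(d) of v : D -> Z u {+oo} to the fraction
   field of D, read off a chosen representative of the fraction; for a
   valuation v the choice is immaterial (frac_valE). *)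
Definition frac_val (D : idomainType) (v : D -> \bar int) (A : {fraction D}) :
    \bar int :=
  (v \n_(repr A) - v \d_(repr A))%E.

Lemma frac_valE (D : idomainType) (v : D -> \bar int) (n d : D) :
    (forall a b, v (a * b) = (v a + v b)%E) ->
    (forall a, a != 0 -> exists k : int, v a = k%:E) ->
    v 0 = +oo%E -> d != 0 ->
  frac_val v (tofrac n / tofrac d) = (v n - v d)%E.
Proof.
move=> vM vfin v0 d0; rewrite /frac_val; set A := _ / _.
have dA0 := denom_ratioP (repr A); set n' := \n_(repr A); set d' := \d_(repr A).
have AE : A = tofrac n' / tofrac d'.
  rewrite -[LHS]reprK /n' /d'; case: (repr A) => -[u w] /= w0.
  have w0F : tofrac w != 0 :> {fraction D} by rewrite tofrac_eq0.
  apply: (mulIf w0F); rewrite divfK // /tofrac; unlock FracField.tofrac.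
  rewrite -[LHS]FracField.pi_mul; apply/eqmodP => /=.
  rewrite FracField.equivfE /FracField.mulf /=.
  by rewrite !numden_Ratio ?mulr1 ?oner_eq0 // mulrC.
have : n' * d = n * d'.
  apply/eqP; rewrite -tofrac_eq !tofracM -eqr_div ?tofrac_eq0 //.
  by rewrite -AE.
move=> /(congr1 v); rewrite !vM.
have [kd vd] := vfin _ d0; have [kd' vd'] := vfin _ dA0.
rewrite -/d' in vd'; rewrite vd vd'.
have [->|/vfin[kn ->]] := eqVneq n 0; have [->|/vfin[kn' ->]] := eqVneq n' 0;
  rewrite ?v0 //=.
by move=> [E]; congr (_%:E); apply/eqP; rewrite subr_eq addrAC -E addrK.
Qed.

Definition padic_val (p : nat) (p_pr : prime p) : padic p_pr -> \bar int :=
  frac_val (@padic_int_val p p_pr).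

Definition gauss_poly_val (p : nat) (p_pr : prime p) (f : {poly (padic p_pr)}) :
    \bar int :=
  \big[Order.min/+oo%E]_(j < size f) padic_val f`_j.

Definition padic_ratfun (p : nat) (p_pr : prime p) : fieldType :=
  {fraction {poly (padic p_pr)}}.

Definition gauss_val (p : nat) (p_pr : prime p) : padic_ratfun p_pr -> \bar int :=
  frac_val (@gauss_poly_val p p_pr).

Definition gauss_ring (p : nat) (p_pr : prime p) : set (padic_ratfun p_pr) :=
  [set U | (0 <= gauss_val U)%E].

Definition gauss_cong (p : nat) (p_pr : prime p) (n : nat)
    (A B : padic_ratfun p_pr) : Prop :=
  exists2 U, gauss_ring U & A - B = p%:R ^+ n * U.

Definition ratfunX (p : nat) (p_pr : prime p) : padic_ratfun p_pr :=
  tofrac 'X.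

Definition fin_dilog (p : nat) (F : fieldType) (t : F) : F :=
  \sum_(1 <= k < p) t ^+ k / k%:R ^+ 2.

(* Main.v *)
From HB Require Import structures.
Require Import Defs.
From mathcomp Require Import all_boot all_order all_algebra all_field.
From mathcomp Require Import constructive_ereal.
From mathcomp Require Import ring zify.
Import Order.TTheory GRing.Theory Num.Theory.

(** Put [y = 1/x], [s = r - 1] and [d_i = 1 - c_i].  Substituting [c = 1 - 1/t]
    in the equation of the [c_i] and clearing denominators gives
      [prod_i (1 - d_i t) = 1 - y t (1 - t)^s]   ([reversed_trinomial]),
    and comparing logarithms ([power_sum_coef]) yields
      [sum_i d_i^k = sum_j k/j (-1)^(k-j) C(sj, k-j) y^j].
    Expanding [c_i^k = (1 - d_i)^k] and summing by Vandermonde's identity gives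
      [sum_i c_i^k = r + sum_j k/j (-1)^j C(sj+k-1, k-j) y^j].
    After multiplication by [x^p] the right-hand side of the congruence is thus
    a polynomial in [x] with rational coefficients ([eval_dilog_poly]), and the
    theorem becomes a congruence modulo [p^2] between the coefficients of [x^m].

    Let [0 < m < p], [j = p - m], and let [f_n] be the polynomial [C(X, n)],
    with [f = f_m].  Up to sign the binomial coefficients in the part divided
    by [p] are [f(-rj)] and [f(sj)]; here [-rj = rm - rp], while the symmetry
    [f(m-1-z) = (-1)^m f(z)] turns the second one into [f(rm-1-sp)].  The
    dilogarithm part is a sum over [n < m] of terms [f_n / (j+n)].  Since
    [j + n] is [-(m - n)] modulo [p], the identity
      [f' = sum_(n < m) (-1)^(m-n-1)/(m-n) f_n]   ([deriv_binp])
    makes it a combination of [f'(-rj)] and [f'(sj)] ([sum_pow_coef_diff]).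
    By Taylor's formula everything is expressed modulo [p^2] through [f] and
    [f'] at [rm] and [rm - 1].  The relation [z f(z-1) = (z-m) f(z)] and its
    derivative at [z = rm] leave exactly [f(rm)/m = C(rm, m)/m]
    ([binomial_coef_cong]).

    The coefficient of [x^0] vanishes, and that of [x^p] is
    [p r^2 sum_(k < p) 1/k^2], divisible by [p^2] because [p > 3]
    ([sum_inv_sq]).  Finally, a polynomial with p-adically integral coefficients
    lies in the Gauss valuation ring ([gauss_ring_tofrac]). *)

Set Implicit Arguments.
Unset Strict Implicit.
Unset Printing Implicit Defensive.
Local Open Scope ring_scope.

(** * Power sums and Newton's logarithmic identity *)

Section PowerSums.
Variable F : fieldType.
Implicit Types (g P A : {poly F}) (N k : nat).

Lemma dvdXn_coef0 N P k : 'X^N %| P -> (k < N)%N -> P`_k = 0.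
Proof. by move=> /dvdpP[Q ->] kN; rewrite coefMXn kN. Qed.

(** The relation [P * A + P' = 0 mod X^N] says that [A] is minus the logarithmic
    derivative of [P] up to order [N]; logarithmic derivatives of products add. *)
Lemma logderiv_prod_mod N (I : finType) (P A : I -> {poly F}) :
  (forall i, 'X^N %| P i * A i + (P i)^`()) ->
  'X^N %| (\prod_i P i) * (\sum_i A i) + (\prod_i P i)^`().
Proof.
move=> PA.
apply: (big_ind2 (fun P A => 'X^N %| P * A + P^`())) => //.
- by rewrite mulr0 derivC addr0 dvdp0.
- move=> P1 A1 P2 A2 h1 h2; rewrite derivM.
  have -> : P1 * P2 * (A1 + A2) + (P1^`() * P2 + P1 * P2^`()) =
    P2 * (P1 * A1 + P1^`()) + P1 * (P2 * A2 + P2^`()) by ring.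
  by rewrite dvdp_addr ?dvdp_mull.
Qed.

(** The coefficients of [- log (prod_i (1 - d_i X))] are the power sums divided
    by [k], while [- log (1 - g) = sum_j g^j / j].  The proof compares
    derivatives modulo [X^N], where both logarithmic derivatives are given by
    truncated geometric series. *)
Lemma power_sum_coef (I : finType) (d : I -> F) g N k :
    (forall n, n.+1%:R != 0 :> F) -> g`_0 = 0 ->
    \prod_i (1 - d i *: 'X) = 1 - g -> (0 < k <= N)%N ->
  \sum_i d i ^+ k = k%:R * \sum_(1 <= j < N.+1) (g ^+ j)`_k / j%:R.
Proof.
move=> natF g0 prodE; case: k => // k /= kN.
have geom (u : {poly F}) : (1 - u) * (\sum_(n < N) u ^+ n) = 1 - u ^+ N.
  by rewrite -opprB mulNr -subrX1 opprB.
pose A i : {poly F} := d i *: \sum_(n < N) (d i *: 'X) ^+ n.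
pose D : {poly F} := \sum_(n < N) g ^+ n * g^`().
have hA : 'X^N %| (1 - g) * (\sum_i A i) + (1 - g)^`().
  rewrite -prodE; apply: logderiv_prod_mod => i.
  have -> : (1 - d i *: 'X) * A i + (1 - d i *: 'X)^`() =
            - (d i ^+ N.+1) *: 'X^N :> {poly F}.
    rewrite /A -scalerAr geom derivB derivC derivZ derivX exprZn.
    by rewrite scaleNr exprS -scalerA scalerBr; ring.
  by rewrite -mul_polyC dvdp_mull.
have gX : 'X %| g by rewrite -['X]subr0 -polyC0 dvdp_XsubCl /root horner_coef0 g0.
have hD : 'X^N %| (1 - g) * D + (1 - g)^`().
  have -> : (1 - g) * D + (1 - g)^`() = - (g ^+ N * g^`()).
    by rewrite /D -mulr_suml mulrA geom derivB derivC; ring.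
  by rewrite dvdpNr dvdp_mulr // dvdp_exp2r.
(* Both [sum_i A i] and [D] are minus the logarithmic derivative of [1 - g];
   since [1 - g] is invertible modulo [X^N], they agree there. *)
have cop : coprimep 'X^N (1 - g).
  rewrite coprimep_expl // coprimep_sym coprimepX /root !hornerE horner_coef0.
  by rewrite g0 subr0 oner_eq0.
have : 'X^N %| \sum_i A i - D.
  rewrite -(Gauss_dvdpr _ cop).
  have -> : (1 - g) * (\sum_i A i - D) =
    ((1 - g) * (\sum_i A i) + (1 - g)^`()) - ((1 - g) * D + (1 - g)^`()) by ring.
  by rewrite dvdp_subr.
move=> /dvdXn_coef0 /(_ kN) /eqP; rewrite coefB subr_eq0 => /eqP.
rewrite !coef_sum => E.
transitivity (\sum_i (A i)`_k).
  apply: eq_bigr => i _; rewrite /A coefZ coef_sum (bigD1 (Ordinal kN)) //=.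
  rewrite exprZn coefZ coefXn eqxx mulr1 big1 ?addr0 -?exprS // => n nk.
  rewrite exprZn coefZ coefXn; case: eqP => [e|]; last by rewrite mulr0.
  by case/eqP: nk; apply: val_inj.
rewrite E big_add1 /= big_mkord mulr_sumr; apply: eq_bigr => n _.
have -> : g ^+ n * g^`() = (n.+1%:R)^-1 *: (g ^+ n.+1)^`().
  by rewrite deriv_exp /= -scaler_nat scalerA mulVf // scale1r mulrC.
by rewrite coefZ coef_deriv -mulr_natl; ring.
Qed.
End PowerSums.

(** * Power sums of the roots of the trinomial *)

Section Trinomial.
Variable F : fieldType.
Hypothesis natF : forall n, n.+1%:R != 0 :> F.
Variables (s : nat) (x : F) (c : 'I_s.+1 -> F).
Hypothesis x0 : x != 0.
Hypothesis cE : x *: ('X - 1) ^+ s.+1 + 'X^s = x *: \prod_i ('X - (c i)%:P).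

(** Evaluate the equation of the [c_i] at [1 - 1/t] and multiply by
    [(-t)^(s+1)].  The target field [K] is kept general because [t] is to be the
    generic element of a field of rational functions. *)
Lemma reversed_trinomial_eval (K : fieldType) (f : {rmorphism F -> K}) (t : K) :
  t != 0 -> f x * (\prod_i (1 - (1 - f (c i)) * t)) = f x - t * (1 - t) ^+ s.
Proof.
move=> t0; have fx0 : f x != 0 by rewrite fmorph_eq0.
have /(congr1 (fun P => (- t) ^+ s.+1 * (map_poly f P).[1 - t^-1])) := cE.
rewrite rmorphD /= !map_polyZ rmorphXn rmorphB /= map_polyX map_polyXn rmorph1.
rewrite rmorph_prod !hornerE /= horner_prod mulrDr => E.
have zE : - t * (1 - t^-1) = 1 - t by field.
have -> : f x - t * (1 - t) ^+ s =
    (- t) ^+ s.+1 * (f x * (1 - t^-1 - 1) ^+ s.+1)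
    + (- t) ^+ s.+1 * (1 - t^-1) ^+ s.
  rewrite mulrCA -exprMn [(- t) ^+ s.+1 in X in _ = _ + X]exprS.
  rewrite -[X in _ = _ + X]mulrA -exprMn zE.
  have -> : - t * (1 - t^-1 - 1) = 1 by field.
  by rewrite expr1n mulr1 mulNr.
rewrite E mulrAC [RHS]mulrC; congr (_ * _).
rewrite -[X in _ ^+ X](card_ord s.+1) -prodr_const -big_split /=.
by apply: eq_bigr => i _; rewrite rmorphB /= map_polyX map_polyC !hornerE /=; field.
Qed.

Lemma reversed_trinomial :
  \prod_i (1 - (1 - c i) *: 'X) = 1 - x^-1 *: ('X * (1 - 'X) ^+ s).
Proof.
pose f : {rmorphism F -> {fraction {poly F}}} := @tofrac {poly F} \o polyC.
have t0 : tofrac 'X != 0 :> {fraction {poly F}} by rewrite tofrac_eq0 polyX_eq0.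
have E := reversed_trinomial_eval f t0.
apply: (scalerI x0); rewrite scalerBr scalerA divff // scale1r.
apply/eqP; rewrite -tofrac_eq; apply/eqP.
transitivity (f x * \prod_i (1 - (1 - f (c i)) * tofrac 'X)); last first.
  by rewrite E -mul_polyC mulr1 !(rmorphB, rmorphM, rmorphXn, rmorph1).
rewrite -mul_polyC rmorphM rmorph_prod; congr (_ * _); apply: eq_bigr => i _.
by rewrite -mul_polyC polyCB !(rmorphB, rmorphM, rmorph1).
Qed.

Lemma coef_1subXn n i : ((1 - 'X) ^+ n : {poly F})`_i = (-1) ^+ i * 'C(n, i)%:R.
Proof.
have -> : (1 - 'X) ^+ n = \poly_(i < n.+1) ((-1) ^+ i * 'C(n, i)%:R) :> {poly F}.
  rewrite exprBn poly_def; apply: eq_bigr => k _.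
  rewrite expr1n mulr1 -mulr_natr -!mul_polyC polyCM -polyC_natr.
  by rewrite rmorphXn rmorphN1 mulrAC.
rewrite coef_poly ltnS; case: leqP => // ni.
by rewrite bin_small // mulr0.
Qed.

Lemma coef_Xn1subXn j k :
  (('X * (1 - 'X) ^+ s) ^+ j : {poly F})`_k =
    if (j <= k)%N then (-1) ^+ (k - j) * 'C(s * j, k - j)%:R else 0.
Proof.
by rewrite exprMn -exprM mulrC coefMXn coef_1subXn ltnNge; case: leqP.
Qed.

(** The upper bound [N] of the sum is arbitrary: the factor [X^j] in
    [(X (1 - X)^s)^j] leaves only the terms with [j <= k]. *)
Lemma power_sum_1subc N k : (0 < k <= N)%N ->
  \sum_i (1 - c i) ^+ k =
    \sum_(1 <= j < N.+1 | (j <= k)%N)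
      k%:R / j%:R * (-1) ^+ (k - j) * 'C(s * j, k - j)%:R / x ^+ j.
Proof.
move=> kN; rewrite (power_sum_coef natF _ reversed_trinomial kN); last first.
  by rewrite coefZ coefXM mulr0.
rewrite mulr_sumr [RHS]big_mkcond; apply: eq_bigr => j _.
rewrite exprZn coefZ coef_Xn1subXn exprVn.
by case: leqP => _; [ring | rewrite mulr0 mul0r mulr0].
Qed.

(** Expand [c^k = (1 - (1 - c))^k] and insert [power_sum_1subc]; the absorption
    identity [n C(k, n) = k C(k-1, n-1)] brings the inner sum to Vandermonde's
    form. *)
Lemma power_sum_c N k : (0 < k <= N)%N ->
  \sum_i c i ^+ k = s.+1%:R +
    \sum_(1 <= j < N.+1 | (j <= k)%N)
      k%:R / j%:R * (-1) ^+ j * 'C(s * j + k.-1, k - j)%:R / x ^+ j.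
Proof.
move=> /andP[k0 kN].
have cD i : c i ^+ k =
    1 + \sum_(1 <= n < k.+1) (-1) ^+ n * 'C(k, n)%:R * (1 - c i) ^+ n.
  rewrite -[c i](subKr 1) exprBn.
  rewrite -(big_mkord xpredT
    (fun n => ((-1) ^+ n * 1 ^+ (k - n) * (1 - c i) ^+ n) *+ 'C(k, n))).
  rewrite big_nat_recl // expr1n !mulr1 big_add1 /= bin0 subKr; congr (_ + _).
  by apply: eq_bigr => n _; rewrite expr1n mulr1 -mulr_natr mulrAC.
rewrite (eq_bigr _ (fun i _ => cD i)) big_split /= sumr_const card_ord; congr (_ + _).
rewrite exchange_big /=.
transitivity (\sum_(1 <= n < k.+1) \sum_(1 <= j < N.+1 | (j <= k)%N)
   (if (j <= n)%N then (-1) ^+ n * 'C(k, n)%:R *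
      (n%:R / j%:R * (-1) ^+ (n - j) * 'C(s * j, n - j)%:R / x ^+ j) else 0)).
  rewrite !big_nat; apply: eq_bigr => n /andP[n0 nk].
  rewrite -mulr_sumr (@power_sum_1subc N) ?n0 /=; last by lia.
  rewrite mulr_sumr -big_mkcondr /=; apply: eq_bigl => j; lia.
rewrite exchange_big /= [LHS]big_nat_cond [RHS]big_nat_cond.
apply: eq_bigr => j /andP[/andP[j0 jN] jk].
have nC n : (0 < n)%N -> (n%:R * 'C(k, n)%:R = k%:R * 'C(k.-1, n.-1)%:R :> F).
  by case: n => // n _; rewrite -!natrM mul_bin_diag.
have vandermonde : 'C(s * j + k.-1, k - j)%:R =
    \sum_(j <= n < k.+1) 'C(s * j, n - j)%:R * 'C(k.-1, n.-1)%:R :> F.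
  rewrite -binomial.Vandermonde natr_sum -[in RHS](add0n j) big_addn big_mkord subSn //.
  apply: eq_bigr => -[a /= ak] _; rewrite addnK natrM; congr (_ * _).
  rewrite -(@bin_sub k.-1 (k - j - a)%N); last by lia.
  congr (('C(_, _))%:R); lia.
rewrite vandermonde mulr_sumr mulr_suml -big_mkcond /= [RHS]big_nat.
rewrite (big_cat_nat j0 (leqW jk)) /= big1_seq ?add0r; last first.
  by move=> n; rewrite mem_index_iota; lia.
rewrite [LHS]big_nat_cond; apply: congr_big => // n; first by lia.
move=> /andP[/andP[jn nk] _].
have -> : (-1) ^+ n = (-1) ^+ j * (-1) ^+ (n - j) :> F by rewrite -exprD subnKC.
have sg : (-1) ^+ (n - j) * (-1) ^+ (n - j) = 1 :> F by rewrite -expr2 sqrr_sign.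
transitivity ((-1) ^+ (n - j) * (-1) ^+ (n - j) * (n%:R * 'C(k, n)%:R) *
  ((-1) ^+ j / j%:R * 'C(s * j, n - j)%:R / x ^+ j)); first by ring.
rewrite sg nC; last by lia.
by ring.
Qed.
End Trinomial.

(** * Binomial coefficients as polynomials *)

(** Locked, so that rewriting with evaluation or scaling rules does not see
    through it. *)
HB.lock Definition binp (F : fieldType) (m : nat) : {poly F} :=
  m`!%:R^-1 *: \prod_(i < m) ('X - i%:R%:P).

Section BinomialPolynomial.
Variable F : fieldType.
Hypothesis natF : forall n, n.+1%:R != 0 :> F.
Implicit Types (m n : nat) (z : F).

Local Notation binp := (@binp F).

Let factF m : m`!%:R != 0 :> F.
Proof. by rewrite -(prednK (fact_gt0 m)) natF. Qed.

Lemma binp0 : binp 0 = 1.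
Proof. by rewrite !binp.unlock big_ord0 invr1 scale1r. Qed.

Lemma binpS m : m.+1%:R *: binp m.+1 = ('X - m%:R%:P) * binp m.
Proof.
rewrite !binp.unlock scalerA factS natrM invfM mulrA divff // mul1r.
by rewrite -scalerAr big_ord_recr /= mulrC.
Qed.

Lemma horner_binp_nat m n : (binp m).[n%:R] = 'C(n, m)%:R.
Proof.
elim: m => [|m IHm]; first by rewrite binp0 bin0 hornerC.
apply: (mulfI (natF m)); rewrite -hornerZ binpS hornerM IHm hornerXsubC.
rewrite -natrM mul_bin_left natrM; have [mn|nm] := leqP m n; first by rewrite natrB.
by rewrite bin_small // !mulr0.
Qed.

(** Under [X |-> m - 1 - X] the roots [0, ..., m - 1] are permuted and each of
    the [m] factors changes sign. *)
Lemma comp_binp_reflect m :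
  binp m \Po (m%:R%:P - 1 - 'X) = (-1) ^+ m *: binp m.
Proof.
rewrite !binp.unlock linearZ /= rmorph_prod /= scalerA mulrC -scalerA; congr (_ *: _).
rewrite (reindex_inj rev_ord_inj) /= -mul_polyC rmorphXn rmorphN1.
rewrite -[X in _ ^+ X](card_ord m) -prodr_const -big_split /=.
apply: eq_bigr => i _; rewrite rmorphB /= comp_polyX comp_polyC natrB // -natr1.
by rewrite polyCB polyCD; ring.
Qed.

Lemma horner_binp_reflect m z :
  (binp m).[m%:R - 1 - z] = (-1) ^+ m * (binp m).[z].
Proof.
have := comp_binp_reflect m; move: (binp m) => B /(congr1 (horner^~ z)).
by rewrite horner_comp !hornerE.
Qed.

Lemma deriv_binp_reflect m z :
  (binp m)^`().[m%:R - 1 - z] = - (-1) ^+ m * (binp m)^`().[z].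
Proof.
have := comp_binp_reflect m; move: (binp m) => B /(congr1 (fun P => P^`().[z])).
rewrite deriv_comp derivZ !derivE !hornerE horner_comp !hornerE => E.
by rewrite mulNr -E; ring.
Qed.

(** Up to the factor [m!] both sides are the product of [X - i] over [i <= m]:
    this is the polynomial form of [z C(z-1, m) = (z-m) C(z, m)]. *)
Lemma comp_binp_shift m :
  'X * (binp m \Po ('X - 1)) = ('X - m%:R%:P) * binp m.
Proof.
rewrite !binp.unlock linearZ /= rmorph_prod /= -!scalerAr; congr (_ *: _).
transitivity (\prod_(i < m.+1) ('X - i%:R%:P) : {poly F}).
  rewrite big_ord_recl subr0; congr (_ * _); apply: eq_bigr => i _.
  by rewrite rmorphB /= comp_polyX comp_polyC -[in RHS]natr1 polyCD; ring.
by rewrite big_ord_recr /= mulrC.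
Qed.

Lemma horner_binp_shift m z : z * (binp m).[z - 1] = (z - m%:R) * (binp m).[z].
Proof.
have := comp_binp_shift m; move: (binp m) => B /(congr1 (horner^~ z)).
by rewrite hornerM horner_comp !hornerE.
Qed.

Lemma deriv_binp_shift m z :
  (binp m).[z - 1] + z * (binp m)^`().[z - 1] =
  (binp m).[z] + (z - m%:R) * (binp m)^`().[z].
Proof.
have := comp_binp_shift m; move: (binp m) => B /(congr1 (fun P => P^`().[z])).
by rewrite !derivM deriv_comp !derivE !hornerE !horner_comp !hornerE /= mulr1.
Qed.

(** This is the coefficient of [t^m] in [d/dz (1+t)^z = log(1+t) (1+t)^z].  It is
    proved by induction on [m] from [(m+1) C(X,m+1) = (X-m) C(X,m)]. *)
Lemma deriv_binp m :
  (binp m)^`() = \sum_(n < m) ((-1) ^+ (m - n).-1 / (m - n)%:R) *: binp n.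
Proof.
elim: m => [|m IHm]; first by rewrite binp0 big_ord0 derivC.
apply: (scalerI (natF m)); rewrite -derivZ binpS derivM derivXsubC mul1r IHm.
(* write [X - m = (X - n) - (m - n)] and raise the index by [binpS] *)
have stepE n : (n < m)%N ->
    ('X - m%:R%:P) * ((-1) ^+ (m - n).-1 / (m - n)%:R *: binp n) =
    ((-1) ^+ (m - n).-1 * n.+1%:R / (m - n)%:R) *: binp n.+1
    + (-1) ^+ (m - n) *: binp n.
  move=> nm; have -> : (m - n)%N = (m - n.+1).+1 by lia.
  have -> : 'X - m%:R%:P = 'X - n%:R%:P - (m - n.+1).+1%:R%:P :> {poly F}.
    by rewrite -subSn // subSS natrB ?polyCB ?(ltnW nm) //; ring.
  rewrite -scalerAr mulrBl -binpS mul_polyC scalerBr !scalerA /= exprS mulN1r scaleNr.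
  by congr (_ *: _ - _ *: _); field; rewrite nat1r natF.
rewrite mulr_sumr (eq_bigr _ (fun (n : 'I_m) _ => stepE n (ltn_ord n))) big_split /=.
(* on the other side, write [m + 1 = (m + 1 - n) + n] *)
have coefE n : (n < m.+1)%N ->
    m.+1%:R *: ((-1) ^+ (m.+1 - n).-1 / (m.+1 - n)%:R *: binp n) =
    (-1) ^+ (m - n) *: binp n + ((-1) ^+ (m - n) * n%:R / (m.+1 - n)%:R) *: binp n.
  rewrite ltnS => nm; rewrite scalerA -scalerDl subSn //=; congr (_ *: _).
  have -> : m.+1%:R = (m - n).+1%:R + n%:R :> F.
    by rewrite -natrD; congr (_%:R); lia.
  by field; rewrite nat1r natF.
rewrite scaler_sumr (eq_bigr _ (fun (n : 'I_m.+1) _ => coefE n (ltn_ord n))).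
rewrite big_split big_ord_recr [X in _ = _ + X]big_ord_recl /= subnn expr0 scale1r.
rewrite mulr0 mul0r scale0r add0r.
rewrite [X in _ = _ + X](_ : _ = \sum_(n < m)
  ((-1) ^+ (m - n).-1 * n.+1%:R / (m - n)%:R) *: binp n.+1); first by ring.
by apply: eq_bigr => i _; rewrite /= /bump /= add1n subSS subnS.
Qed.
End BinomialPolynomial.

(** * Congruences between binomial sums *)

Lemma taylor_order2 (F : fieldType) (O : subringClosed F) (P : {poly F}) (a h : F) :
  P \is a polyOver O -> a \in O -> h \in O ->
  exists2 u, u \in O & P.[a + h] = P.[a] + P^`().[a] * h + h ^+ 2 * u.
Proof.
move=> PO aO hO; exists (\sum_(i < size P) P^`N(i.+2).[a] * h ^+ i).
  apply: rpred_sum => i _; rewrite rpredM ?rpredX //.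
  by rewrite rpred_horner // polyOver_nderivn.
have sz : (size P <= (size P).+2)%N by lia.
rewrite (nderiv_taylor_wide (mulrC _ _) sz) !big_ord_recl nderivn0 nderivn1.
rewrite expr0 mulr1 expr1 addrA; congr (_ + _); rewrite mulr_sumr.
by apply: eq_bigr => i _; rewrite !exprS /=; ring.
Qed.

Lemma taylor_order1 (F : fieldType) (O : subringClosed F) (P : {poly F}) (a h : F) :
  P \is a polyOver O -> a \in O -> h \in O ->
  exists2 u, u \in O & P.[a + h] = P.[a] + h * u.
Proof.
move=> PO aO hO; have [u uO ->] := taylor_order2 PO aO hO.
exists (P^`().[a] + h * u); last by ring.
by rewrite rpredD ?rpredM // rpred_horner ?polyOver_deriv.
Qed.

(** The coefficients of [x^(-j)] in [sum_i (1 - c_i)^k] and in [sum_i c_i^k]; see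
    [power_sum_1subc] and [power_sum_c].  The test on [j <= k] is needed because
    truncated subtraction would make the binomial coefficient [1] for [j > k]. *)
Definition pow_coef_1subc (F : fieldType) (s k j : nat) : F :=
  if (j <= k)%N then k%:R / j%:R * (-1) ^+ (k - j) * 'C(s * j, k - j)%:R else 0.

Definition pow_coef_c (F : fieldType) (s k j : nat) : F :=
  if (j <= k)%N then k%:R / j%:R * (-1) ^+ j * 'C(s * j + k.-1, k - j)%:R else 0.

(** Congruences are taken in a subring [O] that contains the inverses of
    [1, ..., p - 1]; [a = b] modulo [q] is expressed as [a = b + q * u] with
    [u \in O]. *)
Section Congruences.
Variables (F : fieldType) (O : subringClosed F) (p : nat).
Hypothesis natF : forall n, n.+1%:R != 0 :> F.
Hypothesis invO : forall k, (0 < k < p)%N -> k%:R^-1 \in O.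
Hypothesis p_odd : odd p.
Implicit Types (k m n j s : nat).

Local Notation binp := (@binp F).

Let nat_neq0 n : (0 < n)%N -> n%:R != 0 :> F.
Proof. by case: n. Qed.

Lemma sum_congr_mod (I : finType) (P : pred I) (a b : I -> F) (q : F) :
  (forall i, P i -> exists2 u, u \in O & a i = b i + q * u) ->
  exists2 u, u \in O & \sum_(i | P i) a i = \sum_(i | P i) b i + q * u.
Proof.
move=> ab; apply: (big_ind2 (fun a b => exists2 u, u \in O & a = b + q * u)) => //.
  by exists 0; rewrite ?rpred0 // mulr0 addr0.
move=> a1 b1 a2 b2 [u uO ->] [v vO ->]; exists (u + v); first exact: rpredD.
by ring.
Qed.

Lemma binp_over m : (m < p)%N -> binp m \is a polyOver O.
Proof.
elim: m => [|m IHm] mp; first by rewrite binp0 rpred1.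
have -> : binp m.+1 = m.+1%:R^-1%:P * (('X - m%:R%:P) * binp m).
  by rewrite -(binpS natF) mul_polyC scalerA mulVf // scale1r.
by rewrite !rpredM ?polyOverC ?invO ?IHm ?polyOverXsubC ?rpred_nat // ltnW.
Qed.

Lemma inv_sq_reflect k : (0 < k < p)%N ->
  exists2 u, u \in O & (p - k)%:R ^- 2 = k%:R ^- 2 + p%:R * u :> F.
Proof.
move=> /andP[k0 kp]; have pk0 : (0 < p - k)%N by lia.
exists ((k%:R - (p - k)%:R) * (k%:R ^- 2 * (p - k)%:R ^- 2)).
  by rewrite rpredM ?rpredB ?rpred_nat // rpredM // -exprVn rpredX // invO; lia.
have -> : p%:R = k%:R + (p - k)%:R :> F by rewrite -natrD; congr (_%:R); lia.
by field; rewrite !nat_neq0.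
Qed.

Lemma sum_inv_sq_reflect (h : nat) (g : 'I_h -> nat) :
  (forall i, 0 < g i < p)%N ->
  exists2 u, u \in O &
    \sum_(i < h) (p - g i)%:R ^- 2 = \sum_(i < h) (g i)%:R ^- 2 + p%:R * u :> F.
Proof. by move=> gP; apply: sum_congr_mod => i _; apply: inv_sq_reflect. Qed.

(** Let [H] be this sum, [p = 2h + 1] and [A] the sum of [1/i^2] for
    [1 <= i <= h].  Modulo [p], [k] and [p - k] give the same term.  Pairing the
    odd [k] with the even [p - k] gives [H = 2 (A/4)], pairing the two halves of
    the range gives [H = 2 A]; hence [4 H - H = 0], and [3] is invertible. *)
Lemma sum_inv_sq : (3 < p)%N ->
  exists2 u, u \in O & \sum_(1 <= k < p) k%:R ^- 2 = p%:R * u :> F.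
Proof.
move=> p3; pose g k : F := k%:R ^- 2; pose h := p./2.
have ph : p = h.*2.+1 by rewrite -[LHS]odd_double_half p_odd.
have parity n : \sum_(1 <= k < n.*2.+1) g k =
    \sum_(i < n) g i.+1.*2 + \sum_(i < n) g i.*2.+1.
  elim: n => [|n IHn]; first by rewrite big_geq // !big_ord0 addr0.
  by rewrite doubleS 2?big_nat_recr //= IHn !big_ord_recr /= doubleS; ring.
have [u uO uE] : exists2 u, u \in O &
    \sum_(i < h) g i.*2.+1 = \sum_(i < h) g i.+1.*2 + p%:R * u.
  have [|u uO uE] := @sum_inv_sq_reflect h (fun i => i.+1.*2).
    by move=> i; have := ltn_ord i; lia.
  exists u => //; rewrite -uE (reindex_inj rev_ord_inj) /=.
  by apply: eq_bigr => i _; congr (_%:R ^- 2); have := ltn_ord i; lia.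
have [v vO vE] : exists2 v, v \in O &
    \sum_(h.+1 <= k < p) g k = \sum_(i < h) g i.+1 + p%:R * v.
  have [|v vO vE] := @sum_inv_sq_reflect h (fun i => i.+1).
    by move=> i; have := ltn_ord i; lia.
  exists v => //; rewrite -vE (reindex_inj rev_ord_inj) /=.
  rewrite -[h.+1]add0n big_addn big_mkord.
  have -> : (p - h.+1)%N = h by lia.
  by apply: eq_bigr => i _; congr (_%:R ^- 2); have := ltn_ord i; lia.
have E1 : \sum_(1 <= k < p) g k = 2%:R^-1 * \sum_(i < h) g i.+1 + p%:R * u.
  rewrite ph parity -ph uE addrA; congr (_ + _).
  rewrite -big_split mulr_sumr; apply: eq_bigr => i _ /=.
  by rewrite /g -muln2 natrM; field; rewrite nat1r !natF.
have E2 : \sum_(1 <= k < p) g k = 2%:R * \sum_(i < h) g i.+1 + p%:R * v.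
  have hp : (h.+1 <= p)%N by lia.
  rewrite (big_cat_nat (ltn0Sn h) hp) //= vE.
  by rewrite big_add1 big_mkord /=; ring.
exists (3%:R^-1 * (4%:R * u - v)).
  by rewrite rpredM ?rpredB ?rpredM ?rpred_nat // invO.
have -> : \sum_(1 <= k < p) g k =
    3%:R^-1 * (4%:R * \sum_(1 <= k < p) g k - \sum_(1 <= k < p) g k).
  by field; exact: natF.
by rewrite {1}E1 E2; field; rewrite !natF.
Qed.

Lemma pow_coef_1subcE s j n :
  pow_coef_1subc F s (j + n) j =
    (j + n)%:R / j%:R * (-1) ^+ n * (binp n).[(s * j)%:R].
Proof. by rewrite /pow_coef_1subc leq_addr addKn horner_binp_nat. Qed.

(** [C(rj+n-1, n)] with [r = s + 1] is, by reflection, the value at [- rj], which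
    is close to [rm] p-adically when [j = p - m]. *)
Lemma pow_coef_cE s j n : (0 < j)%N ->
  pow_coef_c F s (j + n) j =
    (j + n)%:R / j%:R * (-1) ^+ (j + n) * (binp n).[- (s.+1 * j)%:R].
Proof.
move=> j0; rewrite /pow_coef_c leq_addr addKn -(horner_binp_nat natF) exprD.
have -> : (s * j + (j + n).-1)%:R = n%:R - 1 - (- (s.+1 * j)%:R) :> F.
  have -> : (s * j + (j + n).-1)%N = (n + s.+1 * j - 1)%N by lia.
  by rewrite natrB ?natrD; [ring | lia].
by rewrite horner_binp_reflect !mulrA.
Qed.

(** Only [k = j + n] with [n < m] contribute, and
    [1/(j+n) = - 1/(m-n) + p/((j+n)(m-n))] because [j + m = p].  Replacing
    [1/(j+n)] by [- 1/(m-n)] turns the sum into the expansion [deriv_binp] at two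
    points. *)
Lemma sum_pow_coef_diff s j m : (0 < j)%N -> (0 < m)%N -> (j + m)%N = p ->
  exists2 u, u \in O &
    \sum_(1 <= k < p) (pow_coef_c F s k j - pow_coef_1subc F s k j) / k%:R ^+ 2 =
      - j%:R^-1 * ((binp m)^`().[- (s.+1 * j)%:R]
                   + (-1) ^+ m * (binp m)^`().[(s * j)%:R])
      + p%:R * u.
Proof.
move=> j0 m0 jm; have mp : (m < p)%N by lia.
have jp : (j <= p)%N by lia.
have sgj : (-1) ^+ j = - (-1) ^+ m :> F.
  move: p_odd; rewrite -jm oddD -signr_odd -[(-1) ^+ m]signr_odd.
  by do 2 case: odd; rewrite //= ?opprK.
rewrite (big_cat_nat j0 jp) /= [X in X + _]big1_seq ?add0r; last first.
  move=> k /andP[_]; rewrite mem_index_iota => /andP[_ kj].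
  by rewrite /pow_coef_c /pow_coef_1subc leqNgt kj subrr mul0r.
rewrite -[X in \sum_(X <= _ < _) _](add0n j) big_addn big_mkord.
rewrite !(deriv_binp natF) !horner_sum mulr_sumr -big_split mulr_sumr /=.
have -> : (p - j)%N = m by lia.
apply: sum_congr_mod => -[n /= nm] _; rewrite !hornerZ.
rewrite (addnC n j) pow_coef_cE // pow_coef_1subcE.
set a := (binp n).[- _]; set b := (binp n).[_].
have aO : a \in O by rewrite rpred_horner ?binp_over ?rpredN ?rpred_nat //; lia.
have bO : b \in O by rewrite rpred_horner ?binp_over ?rpred_nat //; lia.
exists (j%:R^-1 * (j + n)%:R^-1 * (m - n)%:R^-1 *
        ((-1) ^+ (m + n.+1) * a - (-1) ^+ n * b)).
  by rewrite !rpredM ?invO ?rpredB ?rpredM ?rpredX ?rpredN ?rpred1 //; lia.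
rewrite exprD sgj.
have -> : (-1) ^+ (m - n).-1 = (-1) ^+ m * (-1) ^+ n.+1 :> F.
  rewrite -exprD -signr_odd -[RHS]signr_odd; congr (_ ^+ (nat_of_bool _)); lia.
have -> : p%:R = (j + n)%:R + (m - n)%:R :> F by rewrite -natrD; congr (_%:R); lia.
have sgm : (-1) ^+ m * (-1) ^+ m = 1 :> F by rewrite -expr2 sqrr_sign.
rewrite exprD ![(-1) ^+ n.+1]exprS.
have jn0 : (j + n)%:R != 0 :> F by rewrite nat_neq0 //; lia.
have mn0 : (m - n)%:R != 0 :> F by rewrite nat_neq0 //; lia.
have {}j0 : j%:R != 0 :> F by rewrite nat_neq0.
move: (j + n)%:R (m - n)%:R jn0 mn0 => y z y0 z0.
have -> : (-1) ^+ m * ((-1) ^+ m * (-1 * (-1) ^+ n) / z * b) = - (-1) ^+ n / z * b.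
  by rewrite !mulrA sgm; ring.
by field; rewrite y0 z0 j0.
Qed.

(** With [r = s + 1], [f = C(X, m)] and [z = rm], the points [- rj = z - rp] and
    [m - 1 - sj = z - 1 - sp] are close to [z] and [z - 1].  Taylor expansion
    reduces the claim to
      [(r-2) f(z) - r f(z-1) + p (r^2 f'(z-1) - rs f'(z)) = (p/m - 1) f(z)],
    which follows from [horner_binp_shift] and [deriv_binp_shift]. *)
Lemma binomial_coef_cong s j m : (0 < j)%N -> (0 < m)%N -> (j + m)%N = p ->
  exists2 u, u \in O &
    'C(s.+1 * m, m)%:R / m%:R -
    (p%:R^-1 * (- (s.+1%:R - 2%:R) * pow_coef_c F s p j
                - s.+1%:R * pow_coef_1subc F s p j)
     + p%:R * s.+1%:R * \sum_(1 <= k < p)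
         (pow_coef_c F s k j - pow_coef_1subc F s k j) / k%:R ^+ 2)
    = p%:R ^+ 2 * u.
Proof.
move=> j0 m0 jm; have mp : (m < p)%N by lia.
have [u5 u5O ->] := sum_pow_coef_diff s j0 m0 jm.
have fO := binp_over mp.
have f'O : (binp m)^`() \is a polyOver O by rewrite polyOver_deriv.
pose z : F := (s.+1 * m)%:R.
have zO : z \in O by rewrite rpred_nat.
have z1O : z - 1 \in O by rewrite rpredB ?rpred1.
have hO n : - (n%:R * p%:R) \in O by rewrite rpredN rpredM ?rpred_nat.
have zrE : - (s.+1 * j)%:R = z + (- (s.+1%:R * p%:R)).
  by rewrite /z -jm !natrM natrD; ring.
have zsE : (s * j)%:R = m%:R - 1 - (z - 1 + (- (s%:R * p%:R))).
  by rewrite /z -jm -[s.+1]addn1 !natrM !natrD; ring.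
have sgm : (-1) ^+ m * (-1) ^+ m = 1 :> F by rewrite -expr2 sqrr_sign.
have sgj : (-1) ^+ p = -1 :> F by rewrite -signr_odd p_odd.
have := pow_coef_cE s m j0; have := pow_coef_1subcE s j m; rewrite jm => -> ->.
rewrite sgj zrE zsE (horner_binp_reflect m) (deriv_binp_reflect m).
have [u1 u1O ->] := taylor_order2 fO zO (hO s.+1).
have [u2 u2O ->] := taylor_order1 f'O zO (hO s.+1).
have [u3 u3O ->] := taylor_order2 fO z1O (hO s).
have [u4 u4O ->] := taylor_order1 f'O z1O (hO s).
rewrite -(horner_binp_nat natF) -/z.
have := horner_binp_shift m z; have := deriv_binp_shift m z.
move: (binp m).[z] (binp m)^`().[z] => A A'.
move: (binp m).[z - 1] (binp m)^`().[z - 1] => B B' eqB' eqB.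
have jO : j%:R^-1 \in O by apply: invO; lia.
(* the remainders [u1, ..., u5] with the coefficients that they receive *)
exists (- (j%:R^-1 * ((s.+1%:R - 2%:R) * s.+1%:R ^+ 2 * u1 - s.+1%:R * s%:R ^+ 2 * u3
           + s.+1%:R * (s.+1%:R * u2 - s%:R * u4)) + s.+1%:R * u5)).
  by rewrite !(rpredN, rpredD, rpredM, rpredX, rpred_nat, rpred1).
have m0' : m%:R != 0 :> F by rewrite nat_neq0.
have j0' : j%:R != 0 :> F by rewrite nat_neq0.
have p0' : p%:R != 0 :> F by rewrite nat_neq0 // -jm ltn_addr.
have r0' := natF s.
have zE : z = s.+1%:R * m%:R by rewrite /z natrM.
have pE : p%:R = j%:R + m%:R :> F by rewrite -jm natrD.
have p1' : j%:R + m%:R != 0 :> F by rewrite -pE.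
have z0 : z != 0 by rewrite zE mulf_neq0.
have BE : B = (s%:R / s.+1%:R) * A.
  by apply: (mulfI z0); rewrite eqB zE; field; rewrite nat1r.
have B'E : B' = (A - B + (z - m%:R) * A') / z.
  apply: (mulfI z0); rewrite mulrCA divff // mulr1; apply: (addrI B).
  by rewrite eqB'; ring.
have sgl (a b : F) : a * (-1) ^+ m * ((-1) ^+ m * b) = a * b.
  by rewrite mulrA -[a * _ * _]mulrA sgm mulr1.
have sgr (b : F) : (-1) ^+ m * (- (-1) ^+ m * b) = - b.
  by rewrite mulrA mulrN sgm mulN1r.
rewrite sgl sgr B'E BE zE pE.
by field; rewrite p1' j0' m0' nat1r r0'.
Qed.

End Congruences.

(** * Both sides as polynomials in x *)

Definition binomial_sum_poly (F : fieldType) (p s : nat) : {poly F} :=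
  \sum_(1 <= k < p) ('C(s.+1 * k, k)%:R / k%:R) *: 'X^k.

(** [x^p] times the power sum; the constant [r] in the power sum of the [c_i] is
    left out, so that both polynomials have degree less than [p]. *)
Definition power_sum_c_poly (F : fieldType) (p s k : nat) : {poly F} :=
  \poly_(m < p) pow_coef_c F s k (p - m).

Definition power_sum_1subc_poly (F : fieldType) (p s k : nat) : {poly F} :=
  \poly_(m < p) pow_coef_1subc F s k (p - m).

(** The right-hand side of the congruence, with [r = s + 1]. *)
Definition dilog_poly (F : fieldType) (p s : nat) : {poly F} :=
  p%:R^-1 *: (2%:R - (s.+1%:R - 2%:R) *: power_sum_c_poly F p s p
                   - s.+1%:R *: power_sum_1subc_poly F p s p)
  + (p%:R * s.+1%:R) *: \sum_(1 <= k < p) k%:R ^- 2 *: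
      (s.+1%:R *: 'X^p + power_sum_c_poly F p s k - power_sum_1subc_poly F p s k).

(** [phi] evaluates polynomials at the given [x] of the extension field. *)
Section Evaluation.
Variables (F L : fieldType) (phi : {rmorphism {poly F} -> L}).
Hypothesis natL : forall n, n.+1%:R != 0 :> L.
Variables (p s : nat) (c : 'I_s.+1 -> L).
Let x := phi 'X.
Hypothesis x0 : x != 0.
Hypothesis cE : x *: ('X - 1) ^+ s.+1 + 'X^s = x *: \prod_i ('X - (c i)%:P).

Let f : {rmorphism F -> L} := phi \o polyC.

Let phiZ a P : phi (a *: P) = f a * phi P.
Proof. by rewrite -mul_polyC rmorphM. Qed.

Let phi_poly E n : phi (\poly_(i < n) E i) = \sum_(i < n) f (E i) * x ^+ i.
Proof.
by rewrite poly_def rmorph_sum; apply: eq_bigr => i _ /=; rewrite phiZ rmorphXn.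
Qed.

Lemma eval_rev_poly E : phi (\poly_(m < p) E (p - m)%N) =
  x ^+ p * \sum_(1 <= j < p.+1) f (E j) / x ^+ j.
Proof.
rewrite phi_poly (reindex_inj rev_ord_inj) /= mulr_sumr big_add1 /= big_mkord.
apply: eq_bigr => i _.
have -> : (p - (p - i.+1) = i.+1)%N by have := ltn_ord i; lia.
have -> : x ^+ p = x ^+ (p - i.+1) * x ^+ i.+1.
  by rewrite -exprD; congr (_ ^+ _); have := ltn_ord i; lia.
by rewrite [RHS]mulrCA -mulrA mulfV ?expf_neq0 // mulr1.
Qed.

Lemma eval_power_sum_1subc_poly k : (0 < k <= p)%N ->
  phi (power_sum_1subc_poly F p s k) = x ^+ p * \sum_i (1 - c i) ^+ k.
Proof.
move=> kp; rewrite (power_sum_1subc natL x0 cE kp) eval_rev_poly; congr (_ * _).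
rewrite [RHS]big_mkcond; apply: eq_bigr => j _; rewrite /pow_coef_1subc.
case: leqP => _; last by rewrite rmorph0 mul0r.
by rewrite !(rmorphM, fmorphV, rmorph_nat, rmorphXn, rmorphN1).
Qed.

Lemma eval_power_sum_c_poly k : (0 < k <= p)%N ->
  phi (power_sum_c_poly F p s k) = x ^+ p * (\sum_i c i ^+ k - s.+1%:R).
Proof.
move=> kp; rewrite (power_sum_c natL x0 cE kp) addrC addKr eval_rev_poly; congr (_ * _).
rewrite [RHS]big_mkcond; apply: eq_bigr => j _; rewrite /pow_coef_c.
case: leqP => _; last by rewrite rmorph0 mul0r.
by rewrite !(rmorphM, fmorphV, rmorph_nat, rmorphXn, rmorphN1).
Qed.

Lemma eval_dilog_poly : (0 < p)%N -> phi (dilog_poly F p s) =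
  p%:R^-1 * (2%:R - (s.+1%:R - 2%:R) * x ^+ p * (\sum_i (c i ^+ p - 1))
                   - s.+1%:R * x ^+ p * (\sum_i (1 - c i) ^+ p))
      + p%:R * s.+1%:R * x ^+ p
        * (\sum_i (fin_dilog p (c i) - fin_dilog p (1 - c i))).
Proof.
move=> p0; have fn n : f n%:R = n%:R by rewrite rmorph_nat.
rewrite /dilog_poly rmorphD !phiZ !rmorphB !phiZ fmorphV rmorphM rmorphB !fn.
rewrite eval_power_sum_c_poly ?p0 ?leqnn // eval_power_sum_1subc_poly ?p0 ?leqnn //.
rewrite rmorph_nat; congr (_ * _ + _).
  by rewrite sumrB sumr_const card_ord -mulrA -mulrA.
rewrite -[RHS]mulrA; congr (_ * _); rewrite rmorph_sum /=.
rewrite sumrB /fin_dilog exchange_big [X in _ - X]exchange_big -sumrB mulr_sumr.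
rewrite !big_nat; apply: eq_bigr => k /andP[k0 kp].
rewrite phiZ rmorphB rmorphD phiZ rmorphXn fmorphV rmorphXn !fn -/x.
have k0p : (0 < k <= p)%N by rewrite k0 ltnW.
rewrite (eval_power_sum_c_poly k0p) (eval_power_sum_1subc_poly k0p).
rewrite -!mulr_suml.
by move: (\sum_i c i ^+ k) (\sum_i (1 - c i) ^+ k) (x ^+ p) => a b y; ring.
Qed.
End Evaluation.

Section Coefficients.
Variables (F : fieldType) (O : subringClosed F) (p : nat).
Hypothesis natF : forall n, n.+1%:R != 0 :> F.
Hypothesis invO : forall k, (0 < k < p)%N -> k%:R^-1 \in O.
Hypothesis p_odd : odd p.
Hypothesis p_gt3 : (3 < p)%N.

Lemma binomial_sum_dilog_cong s :
  p%:R ^- 2 *: (binomial_sum_poly F p s - dilog_poly F p s) \is a polyOver O.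
Proof.
have p0 : p%:R != 0 :> F by rewrite -(prednK (ltnW (ltnW (ltnW p_gt3)))) natF.
apply/polyOverP => m; rewrite coefZ.
suff [u uO ->] : exists2 u, u \in O &
    (binomial_sum_poly F p s - dilog_poly F p s)`_m = p%:R ^+ 2 * u.
  by rewrite mulrA mulVf ?expf_neq0 // mul1r.
rewrite coefB; have -> : (binomial_sum_poly F p s)`_m =
    if (0 < m < p)%N then 'C(s.+1 * m, m)%:R / m%:R else 0.
  rewrite coef_sum; case: ifP => mP.
    rewrite (bigD1_seq m) ?mem_index_iota ?iota_uniq //=.
    rewrite coefZ coefXn eqxx mulr1 big1 ?addr0 // => k km.
    by rewrite coefZ coefXn eq_sym (negPf km) mulr0.
  rewrite big_nat big1 // => k kP; rewrite coefZ coefXn.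
  case: eqP => [mk|_]; last by rewrite mulr0.
  by rewrite mk kP in mP.
have coef_tail k :
    (s.+1%:R *: 'X^p + power_sum_c_poly F p s k - power_sum_1subc_poly F p s k)`_m
   = s.+1%:R * (m == p)%:R + (if (m < p)%N then pow_coef_c F s k (p - m) else 0)
     - (if (m < p)%N then pow_coef_1subc F s k (p - m) else 0).
  by rewrite coefB coefD coefZ coefXn !coef_poly.
have -> : (dilog_poly F p s)`_m =
    p%:R^-1 * (2%:R * (m == 0%N)%:R
      - (s.+1%:R - 2%:R) * (if (m < p)%N then pow_coef_c F s p (p - m) else 0)
      - s.+1%:R * (if (m < p)%N then pow_coef_1subc F s p (p - m) else 0))
    + p%:R * s.+1%:R * \sum_(1 <= k < p)
       (s.+1%:R * (m == p)%:R + (if (m < p)%N then pow_coef_c F s k (p - m) else 0)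
         - (if (m < p)%N then pow_coef_1subc F s k (p - m) else 0)) / k%:R ^+ 2.
  rewrite coefD !coefZ !coefB !coefZ !coef_poly coef_sum.
  rewrite -polyC_natr coefC; congr (_ * (_ - _ - _) + _ * _).
    by case: eqP; rewrite ?mulr1 ?mulr0.
  by apply: eq_bigr => k _; rewrite coefZ coef_tail mulrC.
have p_gt0 : (0 < p)%N by lia.
have [->|m0] := posnP m.
  (* at [m = 0] only [k = p] contributes, with [2 + (r - 2) - r = 0] *)
  have sgp : (-1) ^+ p = -1 :> F by rewrite -signr_odd p_odd.
  exists 0; first exact: rpred0.
  rewrite /= p_gt0 subn0 big_nat big1 => [|k /andP[k0 kp]].
    rewrite /pow_coef_c /pow_coef_1subc leqnn subnn !bin0 sgp.
    by field.
  rewrite /pow_coef_c /pow_coef_1subc leqNgt kp /= (ltn_eqF p_gt0).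
  by rewrite mulr0 addr0 subr0 mul0r.
rewrite /= mulr0 sub0r.
case: (ltngtP m p) => [mp|pm|_].
- have pm0 : (0 < p - m)%N by rewrite subn_gt0.
  have [u uO uE] := binomial_coef_cong natF invO p_odd s pm0 m0 (subnK (ltnW mp)).
  exists u => //; rewrite -uE; congr (_ - (_ * (_ - _) + _ * _)).
    by rewrite mulNr.
  by apply: eq_bigr => k _; rewrite mulr0 add0r.
- exists 0; first exact: rpred0.
  rewrite big1 => [|k _]; first by rewrite !mulr0; ring.
  by rewrite mulr0 addr0 subr0 mul0r.
(* at [m = p] only the constant [r] in the power sums of the [c_i] remains *)
- have [u uO uE] := sum_inv_sq natF invO p_odd p_gt3.
  exists (- (s.+1%:R ^+ 2 * u)); first by rewrite rpredN rpredM ?rpredX ?rpred_nat.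
  rewrite (eq_bigr (fun k => s.+1%:R * k%:R ^- 2)) => [|k _]; last first.
    by rewrite mulr1 addr0 subr0.
  by rewrite -mulr_sumr uE; ring.
Qed.
End Coefficients.

(** * The valuation ring of the p-adic numbers and the Gauss valuation *)

(** The valuation of a fraction is computed on its representative, which this
    equation controls. *)
Lemma tofrac_repr (D : idomainType) (A : {fraction D}) :
  A = tofrac \n_(repr A) / tofrac \d_(repr A).
Proof.
rewrite -[LHS]reprK; case: (repr A) => -[u w] /= w0.
have w0F : tofrac w != 0 :> {fraction D} by rewrite tofrac_eq0.
apply: (mulIf w0F); rewrite divfK // /tofrac; unlock FracField.tofrac.
rewrite -[LHS]FracField.pi_mul; apply/eqmodP => /=.
rewrite FracField.equivfE /FracField.mulf /=.
by rewrite !numden_Ratio ?mulr1 ?oner_eq0 // mulrC.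
Qed.

Lemma fractionP (D : idomainType) (A : {fraction D}) :
  exists n d : D, d != 0 /\ A = tofrac n / tofrac d.
Proof.
exists \n_(repr A), \d_(repr A); split; first exact: denom_ratioP.
exact: tofrac_repr.
Qed.

Section PadicValuation.
Variables (p : nat) (p_pr : prime p).
Local Notation Zp := (padic_int p_pr).
Local Notation Qp := (padic p_pr).
Local Notation v := (@padic_int_val p p_pr).
Implicit Types (a b : Qp) (k l : int).

Lemma residue_nat n i : (n%:R : Zp) i = n%:R.
Proof. by elim: n => [|n IHn] //; rewrite -!natr1 -IHn. Qed.

Lemma residue_nat_eq0 n i : ((n%:R : Zp) i == 0) = (p ^ i.+1 %| n)%N.
Proof.
by rewrite residue_nat -(inj_eq val_inj) /= val_Zp_nat ?pexp_gt1.
Qed.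

Lemma padic_int_nat_neq0 n : (0 < n)%N -> n%:R != 0 :> Zp.
Proof.
move=> n0; apply/eqP => /(congr1 (fun a : Zp => a n)) /eqP.
rewrite residue_nat_eq0 => /dvdn_leq -/(_ n0); apply/negP; rewrite -ltnNge.
by rewrite (ltn_trans (ltnSn n)) // ltn_expl // prime_gt1.
Qed.

Lemma padic_int_val_coprime n : coprime p n -> v n%:R = 0%:E.
Proof.
move=> pn; apply/(padic_int_valE _ 0); split => //.
by rewrite residue_nat_eq0 expn1 -prime_coprime.
Qed.

Lemma padic_int_val_ge0 (x : Zp) : (0 <= v x)%E.
Proof.
have [->|/padic_int_val_fin[n ->]] := eqVneq x 0; last by rewrite lee_fin.
by rewrite (padic_int_val_eqy 0).2.
Qed.

Lemma padic_int_valD (x y : Zp) k :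
  (k%:E <= v x)%E -> (k%:E <= v y)%E -> (k%:E <= v (x + y)%R)%E.
Proof.
move=> kx ky; have [->|/padic_int_val_fin[n vn]] := eqVneq (x + y) 0.
  by rewrite (padic_int_val_eqy 0).2 // leey.
have le_val (z : Zp) : z n != 0 -> (v z <= n%:Z%:E)%E.
  move=> zn; have z0 : z != 0 by apply: contraNneq zn => ->.
  have [m vz] := padic_int_val_fin z0; rewrite vz lee_fin lez_nat leqNgt.
  by apply: contra zn => /((padic_int_valE z m).1 vz).2 ->.
have [xyn _] := (padic_int_valE _ _).1 vn; rewrite vn.
have [xn|/le_val] := eqVneq (x n) 0; last exact: le_trans.
apply: le_trans ky (le_val _ _); apply: contraNneq xyn => yn.
by rewrite -[(x + y) n]/(x n + y n) xn yn addr0.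
Qed.

Lemma padic_val_frac (x y : Zp) : y != 0 ->
  padic_val (tofrac x / tofrac y)%R = (v x - v y)%E.
Proof.
move=> y0; apply: frac_valE => //.
- exact: padic_int_valM.
- by move=> z /padic_int_val_fin[n ->]; exists n%:Z.
- exact: (padic_int_val_eqy _).2.
Qed.

Lemma le_padic_val_frac k (x y : Zp) (e : nat) : v y = e%:Z%:E ->
  (k%:E <= padic_val (tofrac x / tofrac y)%R)%E = ((k + e%:Z)%R%:E <= v x)%E.
Proof.
move=> vy; rewrite padic_val_frac; last first.
  by apply/eqP => /padic_int_val_eqy; rewrite vy.
rewrite vy; case: (v x) (padic_int_val_ge0 x) => [z||] //= _.
- by rewrite !lee_fin lerBrDr.
- by rewrite !leey.
Qed.

(** Over a common denominator the ultrametric inequality is that of the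
    numerators. *)
Lemma le_padic_valD k a b :
  (k%:E <= padic_val a)%E -> (k%:E <= padic_val b)%E -> (k%:E <= padic_val (a + b)%R)%E.
Proof.
have [x [y [y0 ->]]] := fractionP a; have [x' [y' [y'0 ->]]] := fractionP b.
have [e ve] : exists e : nat, v (y * y') = e%:Z%:E.
  by apply: padic_int_val_fin; rewrite mulf_neq0.
have yF : tofrac y != 0 by rewrite tofrac_eq0.
have y'F : tofrac y' != 0 by rewrite tofrac_eq0.
have -> : tofrac x / tofrac y = tofrac (x * y') / tofrac (y * y').
  by rewrite !tofracM -mulf_div divff // mulr1.
have -> : tofrac x' / tofrac y' = tofrac (y * x') / tofrac (y * y').
  by rewrite !tofracM -mulf_div divff // mul1r.
rewrite -mulrDl -tofracD !(le_padic_val_frac _ _ ve).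
exact: padic_int_valD.
Qed.

Lemma le_padic_valM k l a b :
  (k%:E <= padic_val a)%E -> (l%:E <= padic_val b)%E ->
  ((k + l)%R%:E <= padic_val (a * b)%R)%E.
Proof.
have [x [y [y0 ->]]] := fractionP a; have [x' [y' [y'0 ->]]] := fractionP b.
have [e ve] := padic_int_val_fin y0; have [e' ve'] := padic_int_val_fin y'0.
rewrite mulf_div -!tofracM.
rewrite (le_padic_val_frac _ _ ve) (le_padic_val_frac _ _ ve').
rewrite (le_padic_val_frac _ _ (padic_int_valM_fin ve ve')) padic_int_valM.
move=> kx lx; rewrite PoszD addrACA EFinD.
exact: leeD.
Qed.

Lemma le_padic_val_int (x : Zp) : (0%:E <= padic_val (tofrac x : Qp))%E.
Proof.
rewrite -[tofrac x]divr1 -tofrac1 (@le_padic_val_frac _ _ _ 0%N).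
  exact: padic_int_val_ge0.
by have := @padic_int_val_coprime 1; apply; rewrite coprimen1.
Qed.

Lemma padic_natE n : n%:R = tofrac (n%:R : Zp) :> Qp.
Proof. by rewrite rmorph_nat. Qed.

Lemma padic_nat_neq0 n : n.+1%:R != 0 :> Qp.
Proof. by rewrite padic_natE tofrac_eq0 padic_int_nat_neq0. Qed.

Definition padic_ring : {pred Qp} := fun a => (0%:E <= padic_val a)%E.

Lemma padic_ringE a : (a \in padic_ring) = (0%:E <= padic_val a)%E.
Proof. by []. Qed.

Fact padic_ring_subring : subring_closed padic_ring.
Proof.
split=> [|a b|a b]; rewrite !padic_ringE => *.
- rewrite -tofrac1; exact: le_padic_val_int.
- apply: le_padic_valD => //; rewrite -mulN1r -[0]addr0.
  by apply: le_padic_valM => //; rewrite -tofrac1 -tofracN le_padic_val_int.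
- by rewrite -[0]addr0; apply: le_padic_valM.
Qed.
HB.instance Definition _ :=
  GRing.isSubringClosed.Build Qp padic_ring padic_ring_subring.

Lemma padic_ring_invn (k : nat) : (0 < k < p)%N -> (k%:R : Qp)^-1 \in padic_ring.
Proof.
move=> /andP[k0 kp]; rewrite padic_ringE padic_natE -[_^-1]mul1r -tofrac1.
rewrite (@le_padic_val_frac _ _ _ 0%N) ?padic_int_val_ge0 //.
by rewrite padic_int_val_coprime // prime_coprime // gtnNdvd.
Qed.

Lemma le_gauss_poly_val k (f : {poly Qp}) :
  (forall i, (k%:E <= padic_val f`_i)%E) -> (k%:E <= gauss_poly_val f)%E.
Proof.
move=> kf; apply: (big_ind (fun x => k%:E <= x)%E) => [|x y kx ky|i _] //.
  by rewrite leey.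
by rewrite le_min kx.
Qed.

Lemma padic_val0 : padic_val (0 : Qp) = +oo%E.
Proof.
rewrite -[0](mul0r (tofrac 1)^-1) -tofrac0 padic_val_frac ?oner_eq0 //.
by rewrite (padic_int_val_eqy 0).2 // -[1]/(1%:R) padic_int_val_coprime ?coprimen1.
Qed.

Lemma gauss_poly_val_le (f : {poly Qp}) i : (gauss_poly_val f <= padic_val f`_i)%E.
Proof.
have [i_f|f_i] := ltnP i (size f); last by rewrite nth_default // padic_val0 leey.
exact: (@bigmin_le_cond _ _ _ _ (Ordinal i_f)).
Qed.

Lemma padic_val_fin a : a != 0 -> exists k, padic_val a = k%:E.
Proof.
have [x [y [y0 ->]]] := fractionP a => xy0.
have [e ve] := padic_int_val_fin y0.
have [n vn] : exists n : nat, v x = n%:Z%:E.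
  by apply: padic_int_val_fin; apply: contraNneq xy0 => ->; rewrite tofrac0 mul0r.
by exists (n%:Z - e%:Z); rewrite padic_val_frac // vn ve.
Qed.

Lemma padic_val_fin_or_y a : padic_val a = +oo%E \/ exists k, padic_val a = k%:E.
Proof.
have [->|/padic_val_fin] := eqVneq a 0; last by right.
by left; exact: padic_val0.
Qed.

Lemma gauss_poly_val_fin (f : {poly Qp}) : f != 0 -> exists k, gauss_poly_val f = k%:E.
Proof.
move=> f0; have := gauss_poly_val_le f (size f).-1.
have [l ->] : exists l, padic_val f`_(size f).-1 = l%:E.
  by apply: padic_val_fin; rewrite -lead_coefE lead_coef_eq0.
have : gauss_poly_val f = +oo%E \/ exists k, gauss_poly_val f = k%:E.
  apply: (big_ind (fun x => x = +oo%E \/ exists k, x = k%:E)); first by left.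
    move=> x y [->|[k ->]] [->|[l' ->]];
      rewrite ?minxx ?(min_idPl (leey _)) ?(min_idPr (leey _)).
    - by left.
    - by right; exists l'.
    - by right; exists k.
    - by right; exists (Num.min k l'); rewrite EFin_min.
  by move=> i _; apply: padic_val_fin_or_y.
by case=> [->|//]; rewrite leye_eq.
Qed.

(** The representative [n / d] of [u] satisfies [n = u * d], so that only the
    inequality [v(u d) >= v(d)] for integral [u] matters, which is immediate from
    the ultrametric inequality on coefficients. *)
Lemma gauss_ring_tofrac (u : {poly Qp}) :
  u \is a polyOver padic_ring -> gauss_ring (tofrac u : padic_ratfun p_pr).
Proof.
move=> /polyOverP uO; rewrite /gauss_ring /= /gauss_val /frac_val.
set A := tofrac u; set n := \n_(repr A); set d := \d_(repr A).
have d0 : d != 0 by exact: denom_ratioP.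
have -> : n = u * d.
  apply/eqP; rewrite -tofrac_eq tofracM -/A [X in _ == X * _](tofrac_repr A).
  by rewrite divfK // tofrac_eq0.
have [k dk] := gauss_poly_val_fin d0; rewrite dk.
have : (k%:E <= gauss_poly_val (u * d)%R)%E.
  apply: le_gauss_poly_val => i; rewrite coefM.
  apply: (big_ind (fun a => k%:E <= padic_val a)%E).
  - by rewrite padic_val0 leey.
  - by move=> x y; apply: le_padic_valD.
  - move=> j _; rewrite -[k]add0r; apply: le_padic_valM; first exact: uO.
    by rewrite -dk; apply: gauss_poly_val_le.
by case: (gauss_poly_val (u * d)%R) => [z||] //=; rewrite ?lee_fin ?subr_ge0 ?leey.
Qed.

End PadicValuation.

(** * The congruence over the p-adic rational functions *)

Theorem theorem14 (p : nat) (p_pr : prime p) (p_gt3 : (3 < p)%N)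
    (r : nat) (r_ge1 : (1 <= r)%N)
    (L : fieldExtType (padic_ratfun p_pr)) (c_ : 'I_r -> L) :
  let x : padic_ratfun p_pr := ratfunX p_pr in
  let xL : L := x%:A in
  xL *: ('X - 1) ^+ r + 'X^(r - 1) = xL *: (\prod_(i < r) ('X - (c_ i)%:P)) ->
  exists2 B : padic_ratfun p_pr,
    B%:A =
      (p%:R)^-1 * (2%:R - (r%:R - 2%:R) * xL ^+ p * (\sum_(i < r) (c_ i ^+ p - 1))
                   - r%:R * xL ^+ p * (\sum_(i < r) (1 - c_ i) ^+ p))
      + p%:R * r%:R * xL ^+ p
        * (\sum_(i < r) (fin_dilog p (c_ i) - fin_dilog p (1 - c_ i)))
    & gauss_cong 2 (\sum_(1 <= k < p) 'C(r * k, k)%:R * (x ^+ k / k%:R)) B.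
Proof.
case: r r_ge1 c_ => // s _ c_ x xL; rewrite subn1 /= => cE.
pose F : fieldType := padic p_pr.
pose tof : {rmorphism {poly F} -> padic_ratfun p_pr} := @tofrac {poly F}.
pose phi : {rmorphism {poly F} -> L} := in_alg L \o tof.
have natF := padic_nat_neq0 p_pr.
have natK n : n.+1%:R != 0 :> padic_ratfun p_pr.
  by rewrite -(rmorph_nat tof) tofrac_eq0 -polyC_natr polyC_eq0 natF.
have natL n : n.+1%:R != 0 :> L by rewrite -(rmorph_nat (in_alg L)) fmorph_eq0 natK.
have p_gt0 : (0 < p)%N by apply: prime_gt0.
have p_odd : odd p by case: (even_prime p_pr) p_gt3 => [->|].
have p0 : p%:R != 0 :> F by rewrite -(prednK p_gt0) natF.
have xL0 : phi 'X != 0 by rewrite fmorph_eq0 tofrac_eq0 polyX_eq0.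
(* [phi 'X] is convertible to [xL], so the evaluation at [x] applies as is *)
exists (tof (dilog_poly F p s)).
  exact: (eval_dilog_poly natL xL0 cE p_gt0).
exists (tof (p%:R ^- 2 *: (binomial_sum_poly F p s - dilog_poly F p s))).
  apply: gauss_ring_tofrac; apply: binomial_sum_dilog_cong => //.
  exact: padic_ring_invn.
have -> : p%:R ^+ 2 = tof (p%:R ^+ 2)%:P.
  by rewrite polyC_exp rmorphXn polyC_natr rmorph_nat.
rewrite -rmorphM mul_polyC scalerA mulfV ?expf_neq0 // scale1r rmorphB.
congr (_ - _); rewrite rmorph_sum; apply: eq_bigr => k _ /=.
rewrite -mul_polyC rmorphM rmorphXn polyCM rmorphM -[tof 'X]/x.
rewrite polyC_natr rmorph_nat mulrAC mulrA; congr (_ * _ * _).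
case: k => [|k]; first by rewrite !invr0 rmorph0.
apply: (mulfI (natK k)); rewrite mulfV // -(rmorph_nat tof) -rmorphM.
by rewrite -polyC_natr -polyCM mulfV // rmorph1.
Qed.
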